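(* In the category $\mathbf{Raney}_{\mathcal{E}}$, every Raney extension admits a $T_D$ reflection. That is, for every Raney extension $(L,C)$ there are a $T_D$ Raney extension $D(L,C)$ and a morphism $\delta:(L,C)\to D(L,C)$ of $\mathbf{Raney}_{\mathcal{E}}$ such that for every morphism $f:(L,C)\to(M,D)$ of $\mathbf{Raney}_{\mathcal{E}}$ to a $T_D$ Raney extension there is a morphism $f_\delta:D(L,C)\to(M,D)$ of $\mathbf{Raney}_{\mathcal{E}}$ with $f_\delta\circ\delta=f$.
   Context: A Raney extension is a pair $(L,C)$ where $C$ is a coframe, $L\subseteq C$ is a frame such that every element of $C$ is a meet of elements of $L$, and the inclusion preserves arbitrary joins, finite meets, and strongly exact meets of $L$ (a meet $\bigwedge_i x_i$ in $L$ is strongly exact if for all $y\in L$, $x_i\to y=y$ for all $i$ implies $(\bigwedge_i x_i)\to y=y$). A morphism $f:(L,C)\to(M,D)$ of Raney extensions is a coframe map $f:C\to D$ (preserving arbitrary meets and finite joins) with $f[L]\subseteq M$ whose restriction $f|_L:L\to M$ is a frame map. A meet $\bigwedge_i x_i$ in a frame $L$ is exact if $(\bigwedge_i x_i)\vee a=\bigwedge_i(x_i\vee a)$ for all $a\in L$. A frame map $g:L\to M$ is exact if for every exact meet $\bigwedge_i x_i$ in $L$, the meet $\bigwedge_i g(x_i)$ is exact and equals $g(\bigwedge_i x_i)$. $\mathbf{Raney}_{\mathcal{E}}$ is the category of Raney extensions with morphisms of Raney extensions whose restriction to the frame components is exact. A filter is exact if it is closed under exact meets. A Raney extension $(L,C)$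 is $T_D$ if it is $\mathcal{E}$-dense: each element of $C$ is a join of elements of the form $\bigwedge F$ (meet in $C$) with $F$ an exact filter of $L$. *)

(* Defs.v *)
From HB Require Import structures.
From mathcomp Require Import all_boot all_order boolp classical_sets.

Set Implicit Arguments.
Unset Strict Implicit.
Unset Printing Implicit Defensive.

Local Open Scope classical_set_scope.
Local Open Scope order_scope.

HB.mixin Record hasBigJoinMeet (d : Order.disp_t) T of Order.TBLattice d T := {
  bigjoin : set T -> T;
  bigmeet : set T -> T;
  bigjoin_supremums : forall A : set T, supremums A (bigjoin A);
  bigmeet_infimums : forall A : set T, infimums A (bigmeet A)
}.

#[short(type="completeLatticeType")]
HB.structure Definition CompleteLattice (d : Order.disp_t) :=
  {T of Order.TBLattice d T & hasBigJoinMeet d T}.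

HB.mixin Record CompleteLattice_isFrame (d : Order.disp_t) T
    of CompleteLattice d T := {
  meet_bigjoin : forall (x : T) (A : set T),
    Order.meet x (bigjoin A) = bigjoin [set Order.meet x y | y in A]
}.

#[short(type="frameType")]
HB.structure Definition Frame (d : Order.disp_t) :=
  {T of CompleteLattice d T & CompleteLattice_isFrame d T}.

HB.mixin Record CompleteLattice_isCoframe (d : Order.disp_t) T
    of CompleteLattice d T := {
  join_bigmeet : forall (x : T) (A : set T),
    Order.join x (bigmeet A) = bigmeet [set Order.join x y | y in A]
}.

#[short(type="coframeType")]
HB.structure Definition Coframe (d : Order.disp_t) :=
  {T of CompleteLattice d T & CompleteLattice_isCoframe d T}.

Section FrameNotions.
Context {d : Order.disp_t} {L : frameType d}.

Definition himp (x y : L) : L := bigjoin [set z | Order.meet z x <= y].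

(* Whether a meet is exact depends only on the set of its members, so the
   meets of families are represented by meets of sets. *)
Definition exact_meet (A : set L) : Prop :=
  forall a : L,
    Order.join (bigmeet A) a = bigmeet [set Order.join x a | x in A].

Definition strongly_exact_meet (A : set L) : Prop :=
  forall y : L, (forall x, A x -> himp x y = y) -> himp (bigmeet A) y = y.

(* Filters need not be proper. *)
Definition lattice_filter (F : set L) : Prop :=
  [/\ F \top,
      forall x y, F x -> F y -> F (Order.meet x y)
    & forall x y, x <= y -> F x -> F y].

Definition exact_filter (F : set L) : Prop :=
  lattice_filter F /\
  forall A : set L, A `<=` F -> exact_meet A -> F (bigmeet A).

End FrameNotions.

Definition frame_map (d d' : Order.disp_t) (L : frameType d) (M : frameType d')
    (g : L -> M) : Prop :=
  [/\ forall A : set L, g (bigjoin A) = bigjoin (g @` A),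
      g \top = \top
    & forall x y, g (Order.meet x y) = Order.meet (g x) (g y)].

Definition exact_map (d d' : Order.disp_t) (L : frameType d) (M : frameType d')
    (g : L -> M) : Prop :=
  forall A : set L, exact_meet A ->
    exact_meet (g @` A) /\ g (bigmeet A) = bigmeet (g @` A).

Definition coframe_map (d d' : Order.disp_t)
    (C : coframeType d) (D : coframeType d') (f : C -> D) : Prop :=
  [/\ forall A : set C, f (bigmeet A) = bigmeet (f @` A),
      f \bot = \bot
    & forall x y, f (Order.join x y) = Order.join (f x) (f y)].

(* The inclusion of L in C is an order embedding rincl. *)
Record raney := Raney {
  rdispF : Order.disp_t;
  rdispC : Order.disp_t;
  rframe : frameType rdispF;
  rcoframe :> coframeType rdispC;
  rincl : rframe -> rcoframe;
  rincl_le : {mono rincl : x y / x <= y};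
  rincl_generates : forall c : rcoframe,
    exists A : set rframe, c = bigmeet (rincl @` A);
  rincl_bigjoin : forall A : set rframe,
    rincl (bigjoin A) = bigjoin (rincl @` A);
  rincl_top : rincl \top = \top;
  rincl_meet : forall x y : rframe,
    rincl (Order.meet x y) = Order.meet (rincl x) (rincl y);
  rincl_strongly_exact : forall A : set rframe, strongly_exact_meet A ->
    rincl (bigmeet A) = bigmeet (rincl @` A)
}.

(* The map g is the restriction of f to the frame components; it is determined
   by f because rincl is injective. *)
Definition raneyE_morphism (X Y : raney) (f : X -> Y) : Prop :=
  coframe_map f /\
  exists g : rframe X -> rframe Y,
    [/\ forall x, f (rincl x) = rincl (g x), frame_map g & exact_map g].

Definition T_D (X : raney) : Prop :=
  forall c : X, exists S : set X,
    (forall s, S s ->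
       exists2 F : set (rframe X), exact_filter F & s = bigmeet (@rincl X @` F))
    /\ c = bigjoin S.

(* Main.v *)
Require Import Defs.
From HB Require Import structures.
From mathcomp Require Import all_boot all_order boolp classical_sets.

(** Why the theorem is true.

    Each element [c] of a Raney extension [X] on a frame [L] is determined by
    the filter [upset_in_frame c] of the elements of [L] above it, and larger
    elements have smaller filters.  In these terms [X] is a family of filters
    ordered by reverse inclusion, and [X] is T_D exactly when all of its filters
    are exact.

    The key fact is [exact_filter_meetE]: an exact filter [G] of [L] is the
    filter of its own meet computed in [X], whatever [X] is.  Indeed, if [z] in
    [L] lies above that meet, coframe distributivity shows that [z] is the exact
    meet of the [g `|` z] with [g] in [G], hence a member of [G].  All exact
    filters are thus present in every Raney extension of [L], and those which
    are T_D consist of exactly the exact filters.  So the only candidate for the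
    reflection keeps [L] and takes as coframe the exact filters of [L] under
    reverse inclusion; this is a Raney extension because the Heyting implication
    of filters preserves exactness ([exact_filter_residual]), which gives coframe
    distributivity, and because strongly exact meets are exact
    ([strongly_exact_exact]).

    The reflection [td_unit] sends [c] to the exact filter generated by
    [upset_in_frame c].  By the key fact it is right adjoint to [G |-> meet of G
    in X] ([le_td_unit]), so that it preserves meets; finite joins follow from
    [exact_gen_join].

    Given [f : X -> Y] with [Y] T_D and restriction [g] to the frames, the
    extension must send an exact filter [F], the meet of its members, to the
    meet in [Y] of the [rincl (g x)] with [x] in [F].  This works because the
    filters of [Y] are exact and [g] pulls exact filters back to exact filters
    ([exact_filter_preimage]): taking the generated exact filter of a set does
    not change the meet of its image ([exact_gen_image_lb]). *)

Set Implicit Arguments.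
Unset Strict Implicit.
Unset Printing Implicit Defensive.

Import Order.Theory.
Local Open Scope classical_set_scope.
Local Open Scope order_scope.

(** * Meets, joins and implication in complete lattices and frames *)

Lemma eq_of_le d (T : porderType d) (x y : T) :
  (forall z, z <= x <-> z <= y) -> x = y.
Proof.
by move=> h; apply/le_anti/andP; split; apply/h.
Qed.

Section CompleteLatticeTheory.
Context {d : Order.disp_t} {T : completeLatticeType d}.
Implicit Types (x y : T) (A B : set T).

Lemma le_bigmeet x A : x <= bigmeet A <-> forall a, A a -> x <= a.
Proof.
have [lb gb] := bigmeet_infimums A; split=> [h a Aa|h]; last exact: gb.
exact: le_trans h (lb a Aa).
Qed.

Lemma bigjoin_le x A : bigjoin A <= x <-> forall a, A a -> a <= x.
Proof.
have [ub lub] := bigjoin_supremums A; split=> [h a Aa|h]; last exact: lub.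
exact: le_trans (ub a Aa) h.
Qed.

Lemma le_bigmeet_image I (f : I -> T) (J : set I) x :
  x <= bigmeet (f @` J) <-> forall j, J j -> x <= f j.
Proof.
split=> [/le_bigmeet h j Jj|h]; first by apply: h; exists j.
by apply/le_bigmeet => _ [j Jj <-]; exact: h.
Qed.

Lemma bigmeet_image_le I (f : I -> T) (J : set I) j :
  J j -> bigmeet (f @` J) <= f j.
Proof. by move=> Jj; apply: (le_bigmeet_image f J _).1 Jj. Qed.

Lemma bigjoin_image_le I (f : I -> T) (J : set I) x :
  bigjoin (f @` J) <= x <-> forall j, J j -> f j <= x.
Proof.
split=> [/bigjoin_le h j Jj|h]; first by apply: h; exists j.
by apply/bigjoin_le => _ [j Jj <-]; exact: h.
Qed.

End CompleteLatticeTheory.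

Lemma le_join_bigmeet2 d (C : coframeType d) I (f h : I -> C) (J K : set I) c :
  (forall j k, J j -> K k -> c <= f j `|` h k) ->
  c <= bigmeet (f @` J) `|` bigmeet (h @` K).
Proof.
move=> le_c; rewrite join_bigmeet; apply/le_bigmeet_image => _ [k Kk <-].
rewrite joinC join_bigmeet; apply/le_bigmeet_image => _ [j Jj <-].
by rewrite joinC; exact: le_c.
Qed.

Section FrameTheory.
Context {d : Order.disp_t} {L : frameType d}.
Implicit Types (x y z a b : L) (A F G H : set L).

Lemma le_himp x y z : z <= himp x y <-> z `&` x <= y.
Proof.
split=> [le_z|]; last by have [ub _] := bigjoin_supremums [set u | u `&` x <= y];
  exact: ub.
apply: le_trans (_ : himp x y `&` x <= _); first exact: leI2.
rewrite meetC meet_bigjoin; apply/bigjoin_image_le => u /=.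
by rewrite meetC.
Qed.

(** Splitting [b] over [x `|` a] uses frame distributivity only through the
    adjunction: both [x] and [a] lie below [himp b y]. *)
Lemma le_frame_join a b x y : b <= x `|` a -> b `&` x <= y -> a <= y -> b <= y.
Proof.
move=> le_b le_bx le_a.
suff /le_himp : b <= himp b y by rewrite meetxx.
apply: (le_trans le_b); rewrite leUx; apply/andP; split; apply/le_himp.
  by rewrite meetC.
exact: le_trans (leIl _ _) le_a.
Qed.

Lemma frame_join_meet a x y :
  (a `|` x) `&` (a `|` y) <= a `|` (x `&` y).
Proof.
apply: (@le_frame_join a _ x); last exact: leUl.
  by rewrite (le_trans (leIl _ _)) // joinC.
apply: (@le_frame_join a _ y); last exact: leUl.
  by rewrite (le_trans (leIl _ _)) // (le_trans (leIr _ _)) // joinC.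
rewrite -meetA; exact: le_trans (leIr _ _) (leUr _ _).
Qed.

(** * Exact meets and exact filters *)

(** The other inequality in the definition of exactness always holds. *)
Lemma exact_meetP A : exact_meet A <->
  forall a b, (forall x, A x -> b <= x `|` a) -> b <= bigmeet A `|` a.
Proof.
split=> [exA a b le_b|h a]; first by rewrite exA; apply/le_bigmeet_image.
apply/le_anti/andP; split; last by apply: h => x Ax; exact: bigmeet_image_le.
apply/le_bigmeet_image => x Ax; apply: leU2 => //.
by have [lb _] := bigmeet_infimums A; exact: lb.
Qed.

(** Let [b] lie below all [x `|` a], and put [y := bigmeet A `|` a].  Every [x]
    in [A] satisfies [himp x (himp b y) = himp b y], because [b] is covered by
    [x] and [a]; strong exactness transfers this to [bigmeet A], and
    [bigmeet A <= y] then forces [himp b y] to be [\top]. *)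
Lemma strongly_exact_exact A : strongly_exact_meet A -> exact_meet A.
Proof.
move=> seA; apply/exact_meetP => a b le_b; set y := bigmeet A `|` a.
have fix_y : himp (bigmeet A) (himp b y) = himp b y.
  apply: seA => x Ax; apply: eq_of_le => z; split=> [/le_himp/le_himp le_z|].
    apply/le_himp; apply: (@le_frame_join a _ x); last exact: leUr.
      exact: le_trans (leIr _ _) (le_b x Ax).
    by rewrite meetAC.
  by move=> le_z; apply/le_himp; exact: le_trans (leIl _ _) le_z.
have : \top <= himp b y.
  rewrite -fix_y; apply/le_himp/le_himp; rewrite meet1x.
  exact: le_trans (leIl _ _) (leUl _ _).
by move/le_himp; rewrite meet1x.
Qed.

Lemma exact_meet_join A a : exact_meet A -> exact_meet [set x `|` a | x in A].
Proof.
move=> exA b; rewrite -exA -joinA exA image_comp.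
by congr bigmeet; apply/seteqP; split=> _ [x Ax <-]; exists x; rewrite //= joinA.
Qed.

Lemma exact_filter_principal x : exact_filter [set y | x <= y].
Proof.
split; last by move=> A leA _; apply/le_bigmeet.
split=> [|y z /= le_y le_z|y z le_yz /= le_y]; first exact: lex1.
  by rewrite lexI le_y.
exact: le_trans le_y le_yz.
Qed.

Lemma exact_filter_bigcap (S : set (set L)) :
  (forall F, S F -> exact_filter F) ->
  exact_filter [set x | forall F, S F -> F x].
Proof.
move=> exS; split; last first.
  move=> A sA exA F SF; have [_ clF] := exS F SF; apply: clF => //.
  by move=> x Ax; exact: sA.
split=> [F SF|x y Sx Sy F SF|x y le_xy Sx F SF]; have [[F1 FI Fle] _] := exS F SF.
- exact: F1.
- by apply: FI; [exact: Sx|exact: Sy].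
- exact: Fle le_xy (Sx F SF).
Qed.

Lemma exact_filterI F G :
  exact_filter F -> exact_filter G -> exact_filter (F `&` G).
Proof.
move=> [[F1 FI Fle] clF] [[G1 GI Gle] clG]; split; last first.
  by move=> A sA exA; split; [apply: clF|apply: clG] => // x /sA [].
split=> [//|x y [Fx Gx] [Fy Gy]|x y le_xy [Fx Gx]]; split.
- exact: FI.
- exact: GI.
- exact: Fle Fx.
- exact: Gle Gx.
Qed.

(** For upward closed [F] this is the Heyting implication from [F] to [H] in the
    frame of filters; it is exact because joining an exact meet with a fixed
    element gives an exact meet. *)
Lemma exact_filter_residual F H : exact_filter H ->
  exact_filter [set x | forall f, F f -> H (f `|` x)].
Proof.
move=> [[H1 HI Hle] clH]; split; last first.
  move=> A sA exA f Ff; rewrite joinC exA; apply: clH; last exact: exact_meet_join.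
  by move=> _ [x Ax <-]; rewrite joinC; exact: sA.
split=> [f _|x y Hx Hy f Ff|x y le_xy Hx f Ff].
- by rewrite joinx1.
- by apply: Hle (frame_join_meet f x y) _; apply: HI; [exact: Hx|exact: Hy].
- by apply: Hle (Hx f Ff); exact: leU2.
Qed.

Definition exact_gen A : set L :=
  [set x | forall F, exact_filter F /\ A `<=` F -> F x].

Lemma exact_filter_gen A : exact_filter (exact_gen A).
Proof.
by apply: (@exact_filter_bigcap [set F | exact_filter F /\ A `<=` F]) => F [].
Qed.

Lemma sub_exact_gen A : A `<=` exact_gen A.
Proof. by move=> x Ax F [_]; exact. Qed.

Lemma exact_gen_sub A F : exact_filter F -> A `<=` F -> exact_gen A `<=` F.
Proof. by move=> exF sA x; exact. Qed.

(** Two passages to a residual replace [A], then [B], by the exact filter that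
    it generates. *)
Lemma exact_gen_join A B H : exact_filter H ->
  (forall x y, A x -> B y -> H (x `|` y)) ->
  forall x y, exact_gen A x -> exact_gen B y -> H (x `|` y).
Proof.
move=> exH HAB x y Ax By.
have HxB z : B z -> H (z `|` x).
  move: z; apply: exact_gen_sub (exact_filter_residual B exH) _ _ Ax.
  by move=> a Aa b Bb; rewrite joinC; exact: HAB.
have : [set z | forall u, [set x] u -> H (u `|` z)] y; last exact.
apply: exact_gen_sub (exact_filter_residual [set x] exH) _ _ By.
by move=> b Bb _ ->; rewrite joinC; exact: HxB.
Qed.

End FrameTheory.

Lemma exact_filter_preimage d d' (L : frameType d) (M : frameType d')
    (g : L -> M) (H : set M) :
  frame_map g -> exact_map g -> exact_filter H -> exact_filter (g @^-1` H).
Proof.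
move=> [_ g1 gI] exg [[H1 HI Hle] clH]; split; last first.
  move=> A sA /exg [exgA gA] /=; rewrite gA; apply: clH exgA.
  by move=> _ [x Ax <-]; exact: sA.
split=> [|x y Hx Hy|x y le_xy Hx] /=.
- by rewrite g1.
- by rewrite gI; exact: HI.
- by apply: Hle Hx; rewrite leEmeet -gI meet_l.
Qed.

(** * The coframe of exact filters *)

Record exfilter d (L : frameType d) := ExFilter {
  exf_set :> set L;
  exf_exact : exact_filter exf_set
}.

Lemma exf_inj d (L : frameType d) (F G : exfilter L) :
  exf_set F = exf_set G -> F = G.
Proof.
by case: F G => [F exF] [G exG] /= eqFG; subst G; congr ExFilter; exact: Prop_irrelevance.
Qed.

Fact exfilter_display : Order.disp_t. Proof. exact: Order.Disp tt tt. Qed.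

Section ExactFilterCoframe.
Context {d : Order.disp_t} {L : frameType d}.
Local Notation E := (exfilter L).
Implicit Types (F G H : E) (S : set E) (x y : L).

HB.instance Definition _ := gen_eqMixin E.
HB.instance Definition _ := gen_choiceMixin E.

Definition exf_le F G : bool := `[< exf_set G `<=` exf_set F >].

Lemma exf_le_refl : reflexive exf_le.
Proof. by move=> F; apply/asboolP. Qed.

Lemma exf_le_anti : antisymmetric exf_le.
Proof.
move=> F G /andP[/asboolP sGF /asboolP sFG].
by apply: exf_inj; apply/seteqP.
Qed.

Lemma exf_le_trans : transitive exf_le.
Proof.
move=> G F H /asboolP sGF /asboolP sHG; apply/asboolP.
exact: subset_trans sHG sGF.
Qed.

HB.instance Definition _ := Order.Le_isPOrder.Build exfilter_display E
  exf_le_refl exf_le_anti exf_le_trans.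

Lemma exf_leP F G : reflect (exf_set G `<=` exf_set F) (F <= G).
Proof. exact: asboolP. Qed.

Definition exf_gen (A : set L) : E := ExFilter (exact_filter_gen A).

Lemma le_exf_gen F (A : set L) : F <= exf_gen A <-> A `<=` exf_set F.
Proof.
split=> [/exf_leP sAF|sAF]; first exact: subset_trans (@sub_exact_gen _ _ A) sAF.
by apply/exf_leP; apply: exact_gen_sub sAF; exact: exf_exact.
Qed.

Definition exf_meet F G : E := exf_gen (exf_set F `|` exf_set G).
Definition exf_join F G : E := ExFilter (exact_filterI (exf_exact F) (exf_exact G)).

Lemma exf_lexI F G H : (F <= exf_meet G H) = (F <= G) && (F <= H).
Proof.
apply/idP/andP => [/le_exf_gen|[/exf_leP sG /exf_leP sH]].
  by rewrite subUset => -[sG sH]; split; apply/exf_leP.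
by apply/le_exf_gen; rewrite subUset.
Qed.

Lemma exf_leUx F G H : (exf_join F G <= H) = (F <= H) && (G <= H).
Proof.
apply/exf_leP/andP => [|[/exf_leP sF /exf_leP sG]].
  by rewrite subsetI => -[sF sG]; split; apply/exf_leP.
by rewrite subsetI.
Qed.

HB.instance Definition _ :=
  Order.POrder_MeetJoin_isLattice.Build exfilter_display E exf_lexI exf_leUx.

Definition exf_up x : E := ExFilter (exact_filter_principal x).

Lemma le_exf_up F x : F <= exf_up x <-> exf_set F x.
Proof.
have [[_ _ Fle] _] := exf_exact F.
split=> [/exf_leP|Fx]; first by apply=> /=.
by apply/exf_leP => y /= le_xy; exact: Fle Fx.
Qed.

Lemma exf_le0x F : exf_up \bot <= F.
Proof. by apply/exf_leP => x _ /=; exact: le0x. Qed.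

Lemma exf_lex1 F : F <= exf_up \top.
Proof. by apply/le_exf_up; have [[]] := exf_exact F. Qed.

HB.instance Definition _ := Order.hasBottom.Build exfilter_display E exf_le0x.
HB.instance Definition _ := Order.hasTop.Build exfilter_display E exf_lex1.

Definition exf_bigmeet S : E := exf_gen [set x | exists2 F, S F & exf_set F x].

Lemma exf_bigjoin_exact S :
  exact_filter [set x | forall A : set L, (@exf_set d L @` S) A -> A x].
Proof. by apply: exact_filter_bigcap => _ [F _ <-]; exact: exf_exact. Qed.

Definition exf_bigjoin S : E := ExFilter (exf_bigjoin_exact S).

Lemma exf_bigjoin_supremums S : supremums S (exf_bigjoin S).
Proof.
split=> [F SF|F ubF]; apply/exf_leP => x Fx; first by apply: Fx; exists F.
by move=> _ [G SG <-]; exact: (exf_leP _ _ (ubF G SG)).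
Qed.

Lemma exf_bigmeet_infimums S : infimums S (exf_bigmeet S).
Proof.
split=> [F SF|F lbF]; last first.
  by apply/le_exf_gen => x [G SG Gx]; exact: (exf_leP _ _ (lbF G SG)).
by apply/exf_leP => x Fx; apply: sub_exact_gen; exists F.
Qed.

HB.instance Definition _ := hasBigJoinMeet.Build exfilter_display E
  exf_bigjoin_supremums exf_bigmeet_infimums.

Lemma exf_join_bigmeet F S :
  F `|` bigmeet S = bigmeet [set F `|` G | G in S].
Proof.
apply/le_anti/andP; split.
  apply/le_bigmeet_image => G SG; apply: leU2 => //.
  by have [lb _] := bigmeet_infimums S; exact: lb.
apply/exf_leP => x [Fx Sx].
(* Doubling [x] separates its membership in [F] from that in the generated
   filter, so that [exact_gen_join] applies. *)
set H := bigmeet _; rewrite -[x]joinxx.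
apply: (exact_gen_join (exf_exact H)) (sub_exact_gen Fx) Sx => y z Fy [G SG Gz].
apply: sub_exact_gen; exists (F `|` G); first by exists G.
have [[_ _ Fle] _] := exf_exact F; have [[_ _ Gle] _] := exf_exact G.
by split; [apply: Fle Fy; exact: leUl|apply: Gle Gz; exact: leUr].
Qed.

HB.instance Definition _ :=
  CompleteLattice_isCoframe.Build exfilter_display E exf_join_bigmeet.

Lemma exf_up_mono : {mono exf_up : x y / x <= y}.
Proof. by move=> x y; apply/idP/idP => [/le_exf_up //|le_xy]; exact/le_exf_up. Qed.

Lemma exf_meet_up F : F = bigmeet (exf_up @` exf_set F).
Proof.
apply: eq_of_le => G; split=> [/exf_leP sFG|/le_bigmeet_image le_G].
  by apply/le_bigmeet_image => x Fx; apply/le_exf_up; exact: sFG.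
by apply/exf_leP => x Fx; exact/le_exf_up/le_G.
Qed.

Lemma exf_generates F : exists A : set L, F = bigmeet (exf_up @` A).
Proof. by exists (exf_set F); exact: exf_meet_up. Qed.

Lemma exf_up_bigjoin (A : set L) : exf_up (bigjoin A) = bigjoin (exf_up @` A).
Proof.
apply/le_anti/andP; split; last first.
  apply/bigjoin_image_le => x Ax; rewrite exf_up_mono.
  by have [ub _] := bigjoin_supremums A; exact: ub.
apply/exf_leP => y ub_y /=; apply/bigjoin_le => x Ax.
by apply: (ub_y (exf_up x)); exists (exf_up x) => //; exists x.
Qed.

Lemma exf_up_meet x y : exf_up (x `&` y) = exf_up x `&` exf_up y.
Proof.
apply: eq_of_le => F; have [[_ FI Fle] _] := exf_exact F; rewrite lexI.
split=> [/le_exf_up Fxy|/andP[/le_exf_up Fx /le_exf_up Fy]].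
  by apply/andP; split; apply/le_exf_up; apply: Fle Fxy; [exact: leIl|exact: leIr].
by apply/le_exf_up; exact: FI.
Qed.

Lemma exf_up_strongly_exact (A : set L) : strongly_exact_meet A ->
  exf_up (bigmeet A) = bigmeet (exf_up @` A).
Proof.
move=> /strongly_exact_exact exA; apply: eq_of_le => F.
have [[_ _ Fle] clF] := exf_exact F.
split=> [/le_exf_up FA|/le_bigmeet_image le_F].
  apply/le_bigmeet_image => x Ax; apply/le_exf_up; apply: Fle FA.
  by have [lb _] := bigmeet_infimums A; exact: lb.
by apply/le_exf_up; apply: clF exA => x Ax; exact/le_exf_up/le_F.
Qed.

Definition exact_raney : raney :=
  Raney exf_up_mono exf_generates exf_up_bigjoin erefl exf_up_meet
    exf_up_strongly_exact.

Lemma exact_raney_T_D : T_D exact_raney.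
Proof.
move=> F; exists [set F]; split.
  by move=> _ ->; exists (exf_set F); [exact: exf_exact|exact: exf_meet_up].
apply/le_anti/andP; split; last by apply/bigjoin_le => _ ->.
by have [ub _] := bigjoin_supremums [set F]; exact: ub.
Qed.

End ExactFilterCoframe.

(** * Filters of elements of a Raney extension *)

Section RaneyTheory.
Variable X : raney.
Local Notation L := (rframe X).
Implicit Types (c e : X) (x y z : L) (A G : set L).

Definition upset_in_frame c : set L := [set x | c <= rincl x].

Lemma le_upset c e : upset_in_frame e `<=` upset_in_frame c -> c <= e.
Proof.
have [A ->] := rincl_generates e => le_ce.
by apply/le_bigmeet_image => a Aa; apply: le_ce; exact: bigmeet_image_le.
Qed.

Lemma bigmeet_upset c : c = bigmeet (@rincl X @` upset_in_frame c).
Proof.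
apply/le_anti/andP; split; first exact/le_bigmeet_image.
by apply: le_upset => x cx; exact: bigmeet_image_le.
Qed.

Lemma rincl_bot : rincl \bot = \bot :> X.
Proof.
apply/le_anti; rewrite le0x andbT; apply: le_upset => x _.
by rewrite /upset_in_frame /= rincl_le le0x.
Qed.

Lemma rincl_join x y : rincl (x `|` y) = rincl x `|` rincl y :> X.
Proof.
apply/le_anti; rewrite leUx !rincl_le leUl leUr !andbT; apply: le_upset => z.
by rewrite /upset_in_frame /= leUx !rincl_le leUx.
Qed.

(** If [z] lies above the meet of [G] in [X], then for each [a] a lower bound
    in [L] of all [g `|` a] lies, by distributivity in the coframe, below
    [z `|` a].  For [a := z] this makes [z] the meet of the [g `|` z] with [g]
    in [G], for general [a] it makes that meet exact; so [z] is in [G]. *)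
Lemma exact_filter_meetE G z : exact_filter G ->
  bigmeet (@rincl X @` G) <= rincl z <-> G z.
Proof.
move=> [[_ _ Gle] clG]; split=> [le_z|]; last exact: bigmeet_image_le.
have le_join a b : (forall g, G g -> b <= g `|` a) -> b <= z `|` a.
  move=> le_b; rewrite -(rincl_le (r := X)) rincl_join.
  apply: le_trans (_ : bigmeet (@rincl X @` G) `|` rincl a <= _); last exact: leU2.
  rewrite joinC join_bigmeet; apply/le_bigmeet_image => _ [g Gg <-].
  by rewrite joinC -rincl_join rincl_le; exact: le_b.
have meet_z : bigmeet [set g `|` z | g in G] = z.
  apply/le_anti/andP; split; last by apply/le_bigmeet_image => g _; exact: leUr.
  by rewrite -[leRHS]joinxx; apply: le_join => g Gg; exact: bigmeet_image_le.
rewrite -meet_z; apply: clG; first by move=> _ [g Gg <-]; apply: Gle Gg; exact: leUl.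
apply/exact_meetP => a b le_b; rewrite meet_z -[z]joinxx -joinA.
by apply: le_join => g Gg; rewrite joinA; apply: le_b; exists g.
Qed.

Lemma T_D_exact_upset c : T_D X -> exact_filter (upset_in_frame c).
Proof.
move=> /(_ c) [S [exS ->]].
have -> : upset_in_frame (bigjoin S) =
    [set x | forall F, (upset_in_frame @` S) F -> F x].
  apply/seteqP; split=> x /=; rewrite /upset_in_frame /=.
    by move=> /bigjoin_le le_x _ [s Ss <-]; exact: le_x.
  by move=> h; apply/bigjoin_le => s Ss; apply: (h (upset_in_frame s)); exists s.
apply: exact_filter_bigcap => _ [s Ss <-]; have [F exF ->] := exS s Ss.
suff -> : upset_in_frame (bigmeet (@rincl X @` F)) = F by [].
by apply/seteqP; split=> x; rewrite /upset_in_frame /= exact_filter_meetE.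
Qed.

(** * The reflection *)

Definition td_unit c : exact_raney (L := L) := exf_gen (upset_in_frame c).

Lemma le_td_unit (G : exfilter L) c :
  G <= td_unit c <-> bigmeet (@rincl X @` exf_set G) <= c.
Proof.
rewrite le_exf_gen; split=> [sG|le_c x cx].
  by apply: le_upset => x cx; apply: bigmeet_image_le; exact: sG.
by apply/(exact_filter_meetE _ (exf_exact G)); exact: le_trans le_c cx.
Qed.

Lemma td_unit_incl x : td_unit (rincl x) = exf_up x.
Proof.
apply: eq_of_le => G.
by rewrite le_td_unit le_exf_up; apply: exact_filter_meetE; exact: exf_exact.
Qed.

Lemma td_unit_bigmeet (S : set X) :
  td_unit (bigmeet S) = bigmeet (td_unit @` S).
Proof.
apply: eq_of_le => G; rewrite le_td_unit le_bigmeet le_bigmeet_image.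
by split=> le_S c /le_S /le_td_unit.
Qed.

Lemma td_unit_mono c e : c <= e -> td_unit c <= td_unit e.
Proof.
move=> le_ce; apply/le_exf_gen => x ex; apply: sub_exact_gen.
exact: le_trans le_ce ex.
Qed.

Lemma td_unit_join c e : td_unit (c `|` e) = td_unit c `|` td_unit e.
Proof.
apply/le_anti/andP; split; last first.
  by rewrite leUx !td_unit_mono ?leUl ?leUr.
apply/exf_leP => x [cx ex]; rewrite -[x]joinxx.
apply: (exact_gen_join (exf_exact _)) cx ex => y z cy ez.
by apply: sub_exact_gen; rewrite /upset_in_frame /= rincl_join leU2.
Qed.

Lemma td_unit_morphism : raneyE_morphism td_unit.
Proof.
split.
  split; [exact: td_unit_bigmeet| |exact: td_unit_join].
  by rewrite -rincl_bot td_unit_incl.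
exists id; split; first exact: td_unit_incl.
- by split=> // A; rewrite image_id.
- by move=> A exA; rewrite image_id.
Qed.

End RaneyTheory.

(** * Extension along the reflection *)

Section Extension.
Variables (X Y : raney).
Local Notation L := (rframe X).
Variables (f : X -> Y) (g : L -> rframe Y).
Hypothesis tdY : T_D Y.
Hypothesis cof : coframe_map f.
Hypothesis f_incl : forall x, f (rincl x) = rincl (g x).
Hypothesis frg : frame_map g.
Hypothesis exg : exact_map g.

Definition td_extension (F : exact_raney (L := L)) : Y :=
  bigmeet [set rincl (g x) | x in exf_set F].

Lemma exact_gen_image_lb (A : set L) (e : Y) :
  (forall x, exact_gen A x -> e <= rincl (g x)) <->
  (forall x, A x -> e <= rincl (g x)).
Proof.
split=> [lb x /sub_exact_gen|lb x]; first exact: lb.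
have exU := exact_filter_preimage frg exg (T_D_exact_upset e tdY).
exact: (exact_gen_sub exU lb).
Qed.

Lemma td_extension_incl x : td_extension (exf_up x) = rincl (g x).
Proof.
apply/le_anti/andP; split; first by apply: bigmeet_image_le => /=.
apply/le_bigmeet_image => y /= le_xy; rewrite rincl_le leEmeet.
by have [_ _ <-] := frg; rewrite meet_l.
Qed.

Lemma td_extension_bigmeet (S : set (exact_raney (L := L))) :
  td_extension (bigmeet S) = bigmeet (td_extension @` S).
Proof.
apply: eq_of_le => e; rewrite !le_bigmeet_image exact_gen_image_lb.
split=> [lb F SF|lb x [F SF Fx]].
  by apply/le_bigmeet_image => x Fx; apply: lb; exists F.
exact: (le_bigmeet_image _ _ _).1 (lb F SF) x Fx.
Qed.

Lemma td_extension_mono (F G : exfilter L) :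
  F <= G -> td_extension F <= td_extension G.
Proof.
move=> /exf_leP sGF; apply/le_bigmeet_image => x Gx.
by apply: (bigmeet_image_le (fun y => rincl (g y))); exact: sGF.
Qed.

Lemma incl_map_join x y : rincl (g (x `|` y)) = rincl (g x) `|` rincl (g y).
Proof. by have [_ _ fU] := cof; rewrite -!f_incl rincl_join fU. Qed.

Lemma td_extension_join (F G : exfilter L) :
  td_extension (F `|` G) = td_extension F `|` td_extension G.
Proof.
apply/le_anti/andP; split; last by rewrite leUx !td_extension_mono ?leUl ?leUr.
apply: le_join_bigmeet2 => x y Fx Gy; rewrite -incl_map_join.
apply: (bigmeet_image_le (fun z => rincl (g z))).
have [[_ _ Fle] _] := exf_exact F; have [[_ _ Gle] _] := exf_exact G.
by split; [apply: Fle Fx; exact: leUl|apply: Gle Gy; exact: leUr].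
Qed.

Lemma td_extension_morphism : raneyE_morphism td_extension.
Proof.
split; last by exists g; split=> //; exact: td_extension_incl.
split; [exact: td_extension_bigmeet| |exact: td_extension_join].
have [_ f0 _] := cof.
by rewrite [LHS](td_extension_incl \bot) -f_incl rincl_bot.
Qed.

Lemma td_extension_unit : td_extension \o @td_unit X = f.
Proof.
apply/funext => c /=; have [fM _ _] := cof.
rewrite [in RHS](bigmeet_upset c) fM; apply: eq_of_le => e.
rewrite !le_bigmeet_image exact_gen_image_lb.
split=> [lb _ [x cx <-]|lb x cx]; first by rewrite f_incl; exact: lb.
by rewrite -f_incl; apply: lb; exists x.
Qed.

(** Exact filters are meets of principal ones, which come from [L]. *)
Lemma td_extension_unique (h : exact_raney (L := L) -> Y) :
  coframe_map h -> h \o @td_unit X = f -> td_extension = h.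
Proof.
move=> [hM _ _] eq_h; apply/funext => F.
rewrite [in RHS](exf_meet_up F) hM image_comp; congr bigmeet.
apply/seteqP; split=> _ [x Fx <-]; exists x => //=.
- by rewrite -td_unit_incl -f_incl -eq_h.
- by rewrite -f_incl -eq_h /= td_unit_incl.
Qed.

End Extension.

Theorem proposition4p8 (X : raney) :
  exists (DX : raney) (delta : X -> DX),
    [/\ T_D DX,
        raneyE_morphism delta
      & forall (Y : raney) (f : X -> Y),
          T_D Y -> raneyE_morphism f ->
          exists! f_delta : DX -> Y,
            raneyE_morphism f_delta /\ f_delta \o delta = f].
Proof.
exists (exact_raney (L := rframe X)), (@td_unit X); split.
- exact: exact_raney_T_D.
- exact: td_unit_morphism.
move=> Y f tdY [cof [g [f_incl frg exg]]]; exists (td_extension g); split.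
  split; first exact: (td_extension_morphism tdY cof f_incl frg exg).
  exact: (td_extension_unit tdY cof f_incl frg exg).
move=> h [[coh _] eq_h]; exact: (td_extension_unique f_incl coh eq_h).
Qed.
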